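(* Let $T_I$ and $T_{II}$ be two (finite) rooted trees. Then $Q(T_I)=Q(T_{II})$ if and only if $T_I$ and $T_{II}$ can be related by a finite number of stabilizations/destabilizations and one permutation move (that is, there is a finite sequence of rooted trees from $T_I$ to $T_{II}$ in which each tree is obtained from the previous one by a stabilization, a destabilization or a permutation move, exactly one of the steps being a permutation move).
   Context: All rooted trees are finite and are considered up to isomorphism of rooted trees. For a vertex $v$ of a rooted tree $T$, $d(v)$ denotes the number of descendants of $v$ ($v$ itself not counted). **Plucking polynomial.** Embed the rooted tree $T$ in the upper half plane with root at the origin and growing upward (equivalently, order the children of each vertex from left to right). Define $Q(T)\in\mathbb{Z}[q]$ recursively: $Q(T)=1$ if $T$ is a single vertex; if $|E(T)|\ge 1$, $$Q(T)=\sum_{v\in l(T)}q^{r(T,v)}Q(T-v),$$ where $l(T)$ is the set of leaves (non-root vertices without children), $r(T,v)$ is the number of edges of $T$ lying to the right of the unique path from $v$ to the root, and $T-v$ is the embedded rooted tree obtained by deleting $v$. It is known that $Q(T)$ does not depend on the embedding, so it is an invariant of rooted trees. **Stabilization/destabilization.** If the root of $T$ has exactly one child, contracting the edge joining the root to this child (the contracted vertex becoming the root) is a destabilization. The inverse operation (attaching a new root below the old root by one new edge) is a stabilization. **Permutation move.** Let $n\ge 1$, let $v_1,\dots,v_n$ be distinct vertices of a rooted tree $T$, and let $0=\alpha_0<\alpha_1<\cdots<\alpha_n$ and $0=\beta_0<\beta_1<\cdots<\beta_n$ be integers with $\alpha_n=\beta_n$. For each $0\le i\le n-1$ choose pairwise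 disjoint nonempty sets $B_{\alpha_i+1},\dots,B_{\alpha_{i+1}}$ of children of $v_{i+1}$. For each $j$ with $\alpha_i<j\le\alpha_{i+1}$ let $T_j$ be the subtree of $T$ rooted at $v_{i+1}$ consisting of $v_{i+1}$, the vertices in $B_j$ and all descendants of vertices in $B_j$; thus $|E(T_j)|=\sum_{w\in B_j}(d(w)+1)$. Suppose $P$ is a permutation of $\{1,\dots,\alpha_n\}$ such that for every $0\le i\le n-1$ $$\sum_{j=1}^{\alpha_{i+1}-\alpha_i}|E(T_{\alpha_i+j})|=\sum_{j=1}^{\beta_{i+1}-\beta_i}|E(T_{P(\beta_i+j)})|.$$ The permutation move replaces, for all $0\le i\le n-1$ simultaneously, the wedge $T_{\alpha_i+1}\vee\cdots\vee T_{\alpha_{i+1}}$ attached at $v_{i+1}$ by the wedge $T_{P(\beta_i+1)}\vee\cdots\vee T_{P(\beta_{i+1})}$. Some $v_k$ may lie inside a chosen subtree $T_j$ at another $v_i$; in that case the replacement at $v_k$ is carried out inside $T_j$ as well. Precisely, the new tree has the same vertex set and root as $T$; for every $0\le i\le n-1$ and $\beta_i<j\le\beta_{i+1}$, the vertices in $B_{P(j)}$ get $v_{i+1}$ as their new parent, and every other non-root vertex keeps its parent. (The size condition guarantees that the result is again a rooted tree.) *)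

(* Defs.v *)
From HB Require Import structures.
From mathcomp Require Import all_boot all_order all_algebra all_fingroup.

Set Implicit Arguments.
Unset Strict Implicit.
Unset Printing Implicit Defensive.

Import GRing.Theory.

(* A finite rooted tree is given by its vertices and its parent function, with
   the convention that the root is its own parent. Every non-root vertex [w]
   stands for the edge joining [w] to [parent w]. *)
Record rtree := RTree {
  vertex :> finType;
  troot : vertex;
  parent : vertex -> vertex;
  parent_troot : parent troot = troot;
  parent_connect : forall v, fconnect parent v troot
}.

Section RootedTree.
Variable T : rtree.
Implicit Types (u v w x y : T) (A B : {set T}).

Definition children v : {set T} := [set w | (w != troot T) && (parent w == v)].

(* [x] is [w] itself or an ancestor of [w]. *)
Definition above x w : bool := fconnect (@parent T) w x.

Definition descendants v : {set T} := [set w | (w != v) && above v w].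

(* When [B] consists of children of [v], these are the vertices other than [v],
   equivalently the edges, of the subtree formed by [v], [B] and all the
   descendants of vertices in [B]. *)
Definition branch_edges B : {set T} := [set w | [exists x in B, above x w]].

(* An embedding in the upper half plane is a left-to-right order on the children
   of each vertex; [left_of] is meaningless on pairs of non-siblings. *)
Record embedding := Embedding {
  left_of : rel T;
  left_of_irr : forall v, {in children v, irreflexive left_of};
  left_of_trans : forall v, {in children v & &, transitive left_of};
  left_of_total : forall v,
    {in children v &, forall x y, x != y -> left_of x y || left_of y x}
}.

Section Plucking.
Variable e : embedding.

(* Below, [A] is the vertex set of a subtree of [T] with the same root, embedded
   as a part of [T]; the vertices outside [A] have already been plucked. *)
Definition leaves A : {set T} :=
  [set v in A | (v != troot T) && [disjoint children v & A]].

(* The edge [w] lies to the right of the path from [v] to the root when this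
   path and the one from [w] reach a common vertex through siblings [x] and [y],
   with [x] on the left of [y]. *)
Definition right_of_path v w : bool :=
  [exists p, exists x in children p, exists y in children p,
     [&& above x v, above y w & left_of e x y]].

Definition right_edges A v : nat :=
  #|[set w in A | (w != troot T) && right_of_path v w]|.

(* [k] is the number of edges of the subtree [A]. *)
Fixpoint plucking_rec (k : nat) A : {poly int} :=
  (if k is k'.+1
   then \sum_(v in leaves A) 'X^(right_edges A v) * plucking_rec k' (A :\ v)
   else 1)%R.

Definition plucking : {poly int} := plucking_rec #|T|.-1 [set: T].

End Plucking.
End RootedTree.

Definition tree_iso (T T' : rtree) : Prop :=
  exists f : T -> T', [/\ bijective f, f (troot T) = troot T'
    & forall v, f (parent v) = parent (f v)].

(* [T'] is (isomorphic to) the tree obtained from [T] by contracting the edge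
   between the root and its only child [c]; [f] is the contraction map. *)
Definition destabilization (T T' : rtree) : Prop :=
  exists (c : T) (f : T -> T'),
    [/\ children (troot T) = [set c],
        forall v', exists v, f v = v',
        forall u v, f u = f v <->
          u = v \/ (u \in [set troot T; c] /\ v \in [set troot T; c]),
        f (troot T) = troot T'
      & forall v, f (parent v) = parent (f v)].

Definition stabilization (T T' : rtree) : Prop := destabilization T' T.

(* The indices [j] of the subtrees are shifted to start from 0, so that the
   [i]-th block is [alpha i <= j < alpha i.+1]; [v i] is the vertex usually
   written v_(i+1). The bijection [f] identifies the vertices of [T] with those
   of the new tree [T']. *)
Definition block (m : nat) (a : nat -> nat) (i : nat) : pred 'I_m :=
  fun j => a i <= j < a i.+1.

Inductive permutation_move (T T' : rtree) : Prop :=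
  PermutationMove (n m : nat) (v : 'I_n -> T) (alpha beta : nat -> nat)
    (B : 'I_m -> {set T}) (P : {perm 'I_m}) (f : T -> T')
    (n_gt0 : 0 < n)
    (v_inj : injective v)
    (alpha0 : alpha 0 = 0) (alpha_lt : forall i : 'I_n, alpha i < alpha i.+1)
    (alphan : alpha n = m)
    (beta0 : beta 0 = 0) (beta_lt : forall i : 'I_n, beta i < beta i.+1)
    (betan : beta n = m)
    (B_children : forall (i : 'I_n) (j : 'I_m), block alpha i j ->
       B j != set0 /\ B j \subset children (v i))
    (B_disjoint : forall (i : 'I_n) (j k : 'I_m),
       block alpha i j -> block alpha i k -> j != k -> [disjoint B j & B k])
    (P_size : forall i : 'I_n,
       \sum_(j < m | block alpha i j) #|branch_edges (B j)| =
       \sum_(j < m | block beta i j) #|branch_edges (B (P j))|)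
    (f_bij : bijective f)
    (f_root : f (troot T) = troot T')
    (f_moved : forall (i : 'I_n) (j : 'I_m) (w : T),
       block beta i j -> w \in B (P j) -> parent (f w) = f (v i))
    (f_kept : forall w : T, w != troot T -> (forall j, w \notin B j) ->
       parent (f w) = f (parent w)).

(* [tree_moves k T T'] holds when a finite sequence of steps, exactly [k] of
   which are permutation moves, leads from [T] to [T']. *)
Inductive tree_moves : nat -> rtree -> rtree -> Prop :=
| MovesIso T T' : tree_iso T T' -> tree_moves 0 T T'
| MovesStab k T T1 T' :
    stabilization T T1 -> tree_moves k T1 T' -> tree_moves k T T'
| MovesDestab k T T1 T' :
    destabilization T T1 -> tree_moves k T1 T' -> tree_moves k T T'
| MovesPerm k T T1 T' :
    permutation_move T T1 -> tree_moves k T1 T' -> tree_moves k.+1 T T'.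

Lemma embedding_exists (T : rtree) : inhabited (embedding T).
Proof.
exists; exists (fun x y : T => enum_rank x < enum_rank y) => v.
- by move=> x _; rewrite ltnn.
- by move=> y x z _ _ _; apply: ltn_trans.
- by move=> x y _ _ xy; rewrite -neq_ltn -(inj_eq enum_rank_inj) in xy *.
Qed.

Lemma above_cycle (T : rtree) (y : T) : above y (parent y) -> y = troot T.
Proof.
rewrite /above => /iter_findex; move: (findex _ _ _) => c; rewrite -iterSr => yc.
have /iter_findex := parent_connect y; move: (findex _ _ _) => a ya.
have root_fix k : iter k (@parent T) (troot T) = troot T.
  by elim: k => //= k ->; apply: parent_troot.
have yk k : iter (k * c.+1) (@parent T) y = y.
  by elim: k => // k IHk; rewrite mulSn iterD IHk.
have ac : a <= a * c.+1 by apply: leq_pmulr.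
by rewrite -(yk a) -(subnK ac) iterD ya root_fix.
Qed.

Lemma child_above_inj (T : rtree) (v x y w : T) :
  x \in children v -> y \in children v -> above x w -> above y w -> x = y.
Proof.
suff main a b (x' y' : T) : a <= b ->
    x' \in children v -> y' \in children v ->
    iter a (@parent T) w = x' -> iter b (@parent T) w = y' -> x' = y'.
  move=> xv yv /iter_findex xw /iter_findex yw.
  have [ab | /ltnW ba] := leqP (findex (@parent T) w x) (findex (@parent T) w y).
    exact: main ab xv yv xw yw.
  by apply/esym; apply: main ba yv xv yw xw.
rewrite !inE => ab /andP[_ /eqP xv] /andP[y0 /eqP yv] xw.
rewrite -(subnK ab) iterD xw; case: (b - a) => [//|k].
rewrite iterSr xv -yv => ky; case/eqP: y0; apply: above_cycle.
by rewrite /above -{2}ky; apply: fconnect_iter.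
Qed.

Lemma card_branch_edges (T : rtree) (v : T) (B : {set T}) :
  B \subset children v ->
  #|branch_edges B| = \sum_(w in B) #|descendants w|.+1.
Proof.
move=> /subsetP Bv.
transitivity (\sum_(w in B) #|[set u | above w u]|); last first.
  apply: eq_bigr => w _; rewrite (cardsD1 w) inE /above connect0 add1n.
  by congr _.+1; apply: eq_card => u; rewrite !inE.
rewrite -sum1dep_card (eq_bigr (fun=> 1)) //.
under [RHS]eq_bigr => w _ do rewrite -sum1dep_card big_mkcond /=.
rewrite exchange_big big_mkcond /=; apply: eq_bigr => u _.
case: existsP => [[x /andP[xB xu]] | nou].
  rewrite (bigD1 x) //= xu big1 // => y /andP[yB /eqP yx].
  by case: ifP => // yu; case: yx; apply: child_above_inj yu xu; apply: Bv.
rewrite big1 // => x xB; case: ifP => // xu.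
by case: nou; exists x; rewrite xB.
Qed.

(* Main.v *)
Require Import Defs.
From HB Require Import structures.
From mathcomp Require Import all_boot all_order all_algebra all_fingroup.
From mathcomp Require Import all_field.

(* Writing h(v) for the number of vertices of the subtree grown on v, the
   plucking polynomial is given by the q-hook formula
     Q(T) * prod_(v in T) (q^h(v) - 1) = prod_(1 <= i <= |T|) (q^i - 1).
   A stabilization adds the hook |T| + 1 and so does not change Q, and the size
   condition makes every permutation move preserve h. Conversely, stabilize both
   trees up to the same number of vertices: if the polynomials agree, so do the
   products of the q^h(v) - 1, hence the multisets of hooks, because primitive
   roots of unity detect the largest hook. A bijection f preserving the hooks is
   then a single permutation move that detaches all the edges at once: the
   children of v and those of f(v) have the same total size h(v) - 1. *)

Set Implicit Arguments.
Unset Strict Implicit.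
Unset Printing Implicit Defensive.

Import GRing.Theory.

(** * Ancestry and hooks *)

Section Ancestors.
Variable T : rtree.
Implicit Types (p u v w x y c : T) (A : {set T}).

Lemma above_refl v : above v v.
Proof. exact: connect0. Qed.

Lemma above_trans y x z : above x y -> above y z -> above x z.
Proof. by move=> xy yz; apply: connect_trans yz xy. Qed.

Lemma above_parent v : above (parent v) v.
Proof. exact: fconnect1. Qed.

Lemma above_troot v : above (troot T) v.
Proof. exact: parent_connect. Qed.

Lemma above_strict x w : above x w -> w != x -> above x (parent w).
Proof.
move=> /iter_findex <-; case: (findex _ _ _) => [|k]; first by rewrite eqxx.
by move=> _; rewrite iterSr; apply: fconnect_iter.
Qed.

Lemma above_rootE x : above x (troot T) = (x == troot T).
Proof.
apply/idP/eqP=> [/iter_findex <-|->]; last exact: above_refl.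
by elim: (findex _ _ _) => //= k ->; apply: parent_troot.
Qed.

Lemma above_antisym x y : above x y -> above y x -> x = y.
Proof.
move=> xy yx; apply/eqP/contraT=> nxy; rewrite eq_sym in nxy.
have y0 : y = troot T.
  by apply: above_cycle; apply: above_trans yx _; apply: above_strict.
by move: xy nxy; rewrite y0 above_rootE eq_sym => ->.
Qed.

Lemma above_comparable x y w : above x w -> above y w -> above x y || above y x.
Proof.
move=> /iter_findex <- /iter_findex <-.
move: (findex _ _ x) (findex _ _ y) => a b.
by have [ab|/ltnW ba] := leqP a b; apply/orP; [right|left];
  rewrite -(subnK ab) + rewrite -(subnK ba); rewrite iterD; apply: fconnect_iter.
Qed.

Lemma childP p c : reflect (c != troot T /\ parent c = p) (c \in children p).
Proof. by rewrite inE; apply: (iffP andP) => -[c0 /eqP cp]; split=> //; apply/eqP. Qed.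

Lemma above_child p c : c \in children p -> above p c.
Proof. by case/childP=> _ <-; apply: above_parent. Qed.

Lemma child_not_above p c : c \in children p -> ~~ above c p.
Proof.
case/childP=> c0 <-; apply: contra c0 => /above_cycle ->; exact: eqxx.
Qed.

Lemma above_via_child p w :
  above p w -> w != p -> exists2 c, c \in children p & above c w.
Proof.
move=> /iter_findex; elim: (findex _ _ _) => [|k IHk] /= pw wp.
  by rewrite pw eqxx in wp.
have [/IHk|kp] := eqVneq (iter k (@parent T) w) p; first by apply.
exists (iter k (@parent T) w); last exact: fconnect_iter.
apply/childP; split=> //; apply: contra kp => /eqP k0.
by rewrite k0 -pw k0 parent_troot.
Qed.

(** [A] stands for the vertices not yet plucked, as in [plucking_rec]: hooks of the pruned trees are
    all read inside the fixed tree [T]. *)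
Definition hook A v := #|[set w in A | above v w]|.

(** A proper descendant of [p] lies over exactly one child of [p]. The operation is arbitrary
    because the hook walk needs this for sums over leaves and for products along paths. *)
Lemma sum_below (R : Type) (idx : R) (op : Monoid.com_law idx) (P : pred T)
    (F : T -> R) p :
  \big[op/idx]_(w | P w && above p w) F w =
  op (if P p then F p else idx)
     (\big[op/idx]_(c in children p) \big[op/idx]_(w | P w && above c w) F w).
Proof.
rewrite big_mkcond (bigD1 p) //= above_refl andbT; congr (op _ _).
under [RHS]eq_bigr do rewrite big_mkcond /=.
rewrite exchange_big [LHS]big_mkcond /=; apply: eq_bigr => w _.
have [->|wp] := eqVneq w p.
  by rewrite big1 // => c /child_not_above /negPf ->; rewrite andbF.
case: (boolP (above p w)) => [pw|npw].
  have [c cp cw] := above_via_child pw wp.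
  rewrite (bigD1 c) //= cw big1 ?Monoid.mulm1 // => c' /andP[c'p c'c].
  case: ifP => // /andP[_ c'w]; case/eqP: c'c.
  exact: child_above_inj c'p cp c'w cw.
rewrite andbF big1 // => c cp; case: ifP => // /andP[_ cw].
by case/negP: npw; apply: above_trans cw; apply: above_child.
Qed.

Lemma hookE A v : hook A v = \sum_(w | (w \in A) && above v w) 1.
Proof. by rewrite /hook -sum1_card; apply: eq_bigl => w; rewrite inE. Qed.

Lemma hook_rec A p : hook A p = (p \in A) + \sum_(c in children p) hook A c.
Proof.
rewrite hookE sum_below /=; congr (_ + _).
by apply: eq_bigr => c _; rewrite hookE.
Qed.

Lemma hook_troot A : hook A (troot T) = #|A|.
Proof. by rewrite /hook; apply: eq_card => w; rewrite !inE above_troot andbT. Qed.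

Lemma hook_gt0 A v : v \in A -> 0 < hook A v.
Proof. by move=> vA; rewrite hook_rec vA. Qed.

Lemma hookT_gt0 v : 0 < hook setT v.
Proof. by rewrite hook_gt0 ?inE. Qed.

Lemma hook_child p c : c \in children p -> hook setT c < hook setT p.
Proof. by move=> cp; rewrite (hook_rec _ p) in_setT (bigD1 c cp) /= ltnS leq_addr. Qed.

Lemma hookT_max v : v != troot T -> hook setT v < #|T|.
Proof.
move=> v0; have [c c0 cv] := above_via_child (above_troot v) v0.
rewrite -cardsT -hook_troot; apply: leq_ltn_trans (hook_child c0).
apply/subset_leq_card/subsetP=> w; rewrite !inE; exact: above_trans.
Qed.

Lemma descendants_hook v : #|descendants v|.+1 = hook setT v.
Proof.
rewrite /hook [RHS](cardsD1 v) !inE above_refl /= add1n; congr _.+1.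
by apply: eq_card => w; rewrite !inE.
Qed.

(** Hooks strictly decrease from parent to child. *)
Lemma tree_ind (P : T -> Prop) :
  (forall p, (forall c, c \in children p -> P c) -> P p) -> forall p, P p.
Proof.
move=> IH p; have [n] := ubnP (hook setT p); elim: n p => // n IHn p pn.
apply: IH => c /hook_child cp; apply: IHn; apply: leq_trans cp _; exact: pn.
Qed.

(** Allows a bijection that does not respect ancestry to transport hooks: only the sums over
    children have to agree. *)
Lemma hook_unique (phi : T -> nat) :
  (forall p, phi p = 1 + \sum_(c in children p) phi c) -> phi =1 hook setT.
Proof.
move=> phi_rec; apply: tree_ind => p IHp.
by rewrite phi_rec hook_rec inE; congr (_ + _); apply: eq_bigr => c /IHp.
Qed.

End Ancestors.

(** * Edges to the right of a path, and plucked subtrees *)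

Section RightOfPath.
Variables (T : rtree) (e : embedding T).
Implicit Types (p u v w x y c : T) (A : {set T}).

Lemma right_of_pathP v w :
  reflect (exists p x y, [/\ x \in children p, y \in children p,
             above x v, above y w & left_of e x y])
          (right_of_path e v w).
Proof.
apply: (iffP existsP) => [[p /exists_inP[x xp /exists_inP[y yp /and3P[]]]]|].
  by move=> *; exists p, x, y.
move=> [p [x [y [xp yp xv yw xy]]]]; exists p.
by apply/exists_inP; exists x => //; apply/exists_inP; exists y => //; apply/and3P.
Qed.

Lemma left_of_childF p c : c \in children p -> left_of e c c = false.
Proof. exact: left_of_irr. Qed.

Lemma right_of_path_comparable v w :
  above v w || above w v -> right_of_path e v w = false.
Proof.
move=> vw; apply/right_of_pathP=> -[p [x [y [xp yp xv yw]]]].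
suff -> : x = y by rewrite (left_of_childF yp).
by case/orP: vw => [/(above_trans xv)|/(above_trans yw)] *; apply: child_above_inj; eauto.
Qed.

Lemma right_of_path_children p c c' v w :
  c \in children p -> c' \in children p -> c' != c -> above c v -> above c' w ->
  right_of_path e v w = left_of e c c'.
Proof.
move=> cp c'p c'c cv c'w; apply/right_of_pathP/idP=> [|cc']; last by exists p, c, c'.
case=> [q [x [y [xq yq xv yw xy]]]].
have xNy : x <> y by move=> exy; rewrite exy (left_of_childF yq) in xy.
have [exc|xc] := eqVneq x c.
  have epq : p = q by case/childP: cp => _ <-; case/childP: xq => _ <-; rewrite exc.
  rewrite -epq in yq.
  by rewrite -exc -(child_above_inj yq c'p yw c'w).
have above_parent_child a b : above a b -> b != a -> forall d, b \in children d -> above a d.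
  by move=> ab ba d /childP[_ <-]; apply: above_strict.
(* If [x] is a proper ancestor of [c], it is also an ancestor of [w], which forces [x = y]. If [c]
   is a proper ancestor of [x], it is also an ancestor of [w], which forces [c = c']. *)
case/orP: (above_comparable xv cv) => [xac|cax].
  case: xNy; apply: child_above_inj xq yq _ yw.
  apply: above_trans c'w; apply: above_trans (above_child c'p).
  by apply: above_parent_child cp; rewrite // eq_sym.
case/eqP: c'c; apply: child_above_inj c'p cp c'w _.
apply: above_trans yw; apply: above_trans (above_child yq).
exact: above_parent_child xq.
Qed.

(** A version of [right_edges] local to the branch on [p], which makes induction on the tree
    possible. *)
Definition right_edges_below A p v : nat :=
  #|[set w in A | above p w && right_of_path e v w]|.

Lemma right_edges_belowE A p v : right_edges_below A p v =
  \sum_(w | ((w \in A) && right_of_path e v w) && above p w) 1.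
Proof.
by rewrite /right_edges_below -sum1_card; apply: eq_bigl => w; rewrite inE -andbA [_ && above _ _]andbC.
Qed.

(** The branch of a sibling of [c] lies wholly on one side of the path to [v], and [p] is on the
    path. *)
Lemma right_edges_below_child A p c v : c \in children p -> above c v ->
  right_edges_below A p v =
  (\sum_(c' in children p | left_of e c c') hook A c' + right_edges_below A c v)%N.
Proof.
move=> cp cv; rewrite right_edges_belowE sum_below /=.
rewrite right_of_path_comparable ?(above_trans (above_child cp) cv) ?orbT // andbF add0n.
rewrite (bigD1 c) //= -right_edges_belowE addnC; congr (_ + _)%N.
rewrite [RHS]big_mkcondr [RHS](bigD1 c) //= (left_of_childF cp) add0n.
apply: eq_bigr => c' /andP[c'p c'c].
have -> : \sum_(w | ((w \in A) && right_of_path e v w) && above c' w) 1 =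
          \sum_(w | ((w \in A) && left_of e c c') && above c' w) 1.
  apply: eq_bigl => w; case: (boolP (above c' w)) => c'w; rewrite ?andbF // !andbT.
  by rewrite (right_of_path_children cp c'p).
case: (left_of e c c'); first by rewrite hookE; apply: eq_bigl => w; rewrite andbT.
by rewrite big_pred0 // => w; rewrite andbF.
Qed.

Lemma right_edges_below_self A p : right_edges_below A p p = 0.
Proof.
apply/eqP; rewrite cards_eq0; apply/eqP/setP=> w; rewrite !inE.
case: (boolP (above p w)) => pw; rewrite ?andbF //.
by rewrite right_of_path_comparable ?pw //= andbF.
Qed.

Lemma right_edges_troot A v : right_edges e A v = right_edges_below A (troot T) v.
Proof.
apply: eq_card => w; rewrite !inE above_troot /=; congr (_ && _).
have [->|//] := eqVneq w (troot T).
by rewrite right_of_path_comparable // above_troot orbT.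
Qed.

(** The nonempty sets of this kind are the vertex sets of the subtrees with the same root as [T]. *)
Definition ancestor_closed A : Prop := forall w, w \in A -> parent w \in A.

Lemma ancestor_closed_above A v w :
  ancestor_closed A -> above v w -> w \in A -> v \in A.
Proof.
by move=> Acl /iter_findex <-; elim: (findex _ _ _) => //= k IHk /IHk; apply: Acl.
Qed.

Lemma ancestor_closed_hook0 A v : ancestor_closed A -> v \notin A -> hook A v = 0.
Proof.
move=> Acl vA; apply/eqP; rewrite cards_eq0; apply/eqP/setP=> w; rewrite !inE.
by apply: contraNF vA => /andP[wA vw]; apply: ancestor_closed_above vw wA.
Qed.

(** The bound on [#|A|] excludes the lone root, which has hook 1 without being a leaf. *)
Lemma in_leaves A v : ancestor_closed A -> 1 < #|A| ->
  (v \in leaves A) = (v \in A) && (hook A v == 1).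
Proof.
move=> Acl A1; rewrite inE; case: (boolP (v \in A)) => //= vA.
rewrite hook_rec vA /= add1n eqSS sum_nat_eq0.
apply/andP/forall_inP=> [[_ dv] c cv|hc].
  by apply/eqP/ancestor_closed_hook0; rewrite // (disjointFr dv).
have dv : [disjoint children v & A].
  rewrite disjoint_subset; apply/subsetP=> c cv; rewrite inE.
  by apply: contraTN (hc c cv) => cA; rewrite -lt0n hook_gt0.
split=> //; apply: contraTneq A1 => v0; rewrite -(hook_troot A) -v0 hook_rec.
by rewrite big1 ?vA // => c /hc /eqP.
Qed.

Lemma hookD1 A v u : v \in A -> hook A u = hook (A :\ v) u + above u v.
Proof.
move=> vA; rewrite /hook (cardsD1 v) !inE vA addnC /=; congr (_ + _).
by apply: eq_card => w; rewrite !inE andbA.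
Qed.

Lemma ancestor_closedD1 A v : ancestor_closed A -> v \in leaves A ->
  ancestor_closed (A :\ v).
Proof.
rewrite inE => Acl /and3P[vA v0 dv] w; rewrite !inE => /andP[wv wA].
rewrite Acl // andbT; apply: contraTneq dv => pw.
apply/pred0Pn; exists w; rewrite /= wA andbT inE pw eqxx andbT.
by apply: contra wv => /eqP w0; rewrite -pw w0 parent_troot.
Qed.

End RightOfPath.

(** * The q-analogue of the hook walk *)

Section HookWalk.
Local Open Scope ring_scope.
Variables (F : fieldType) (q : F).
Hypothesis q_order : forall n, (0 < n)%N -> q ^+ n - 1 != 0.
Let g n := q ^+ n - 1.

(* The summands are differences [q ^+ (s + h c) - q ^+ s] of consecutive partial
   sums [s], so that the sum telescopes. *)
Lemma sum_staircase (I : finType) (lt : rel I) (h : I -> nat) (C : {set I}) :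
    {in C, irreflexive lt} -> {in C & &, transitive lt} ->
    {in C &, forall x y, x != y -> lt x y || lt y x} ->
  \sum_(c in C) q ^+ (\sum_(c' in C | lt c c') h c')%N * g (h c) =
  g (\sum_(c in C) h c)%N.
Proof.
have [n] := ubnP #|C|; elim: n C => // n IHn C Cn irr tr tot.
have [->|[c1 c1C]] := set_0Vmem C; first by rewrite !big_set0 /g subrr.
pose N c := #|[set d in C | lt c d]|.
(* The element [c0] with the most elements to its right is the leftmost one, since anything on its
   left would have strictly more. *)
case: (arg_maxnP N c1C) => c0 /= c0C0 c0max; have {c0C0} c0C : c0 \in C := c0C0.
have c0min c : c \in C -> c != c0 -> lt c0 c /\ lt c c0 = false.
  move=> cC cc0; have Nlt : lt c c0 = false.
    apply/negP=> ltc; have := c0max c cC; rewrite /= leqNgt => /negP; apply.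
    apply/proper_card/properP; split.
      apply/subsetP=> d; rewrite !inE => /andP[dC c0d]; rewrite dC /=.
      exact: (tr c0 c d).
    by exists c0; rewrite !inE c0C ?ltc // irr.
  by have := tot _ _ cC c0C cc0; rewrite Nlt.
have IH : \sum_(c in C :\ c0) q ^+ (\sum_(c' in C :\ c0 | lt c c') h c')%N * g (h c) =
  g (\sum_(c in C :\ c0) h c)%N.
  have sub x : x \in C :\ c0 -> x \in C by rewrite inE => /andP[].
  apply: IHn => [|x /sub|x y z /sub ? /sub ? /sub ?|x y /sub ? /sub ?].
  - by move: Cn; rewrite (cardsD1 c0) c0C.
  - exact: irr.
  - exact: tr.
  - exact: tot.
have eqC c c' : (c' \in C) && lt c c' = (c' \in C :\ c0) && lt c c' || (c' == c0) && lt c c0.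
  by rewrite in_setD1; case: eqVneq => [->|]; rewrite ?c0C ?orbF //=.
rewrite (big_setD1 c0) //= [in RHS](big_setD1 c0) //=.
(* All the rest lies to the right of [c0], so with [S] its total size the term of [c0] is
   [q ^+ (S + h c0) - q ^+ S], while the other terms add up to [q ^+ S - 1]. *)
have -> : (\sum_(c' in C | lt c0 c') h c' = \sum_(c in C :\ c0) h c)%N.
  apply: eq_bigl => c; rewrite in_setD1; have [->|cc0] := eqVneq c c0.
    by rewrite irr ?andbF.
  by case: (boolP (c \in C)) => //= cC; rewrite (c0min c cC cc0).1.
rewrite [X in _ + X](eq_bigr (fun c => q ^+ (\sum_(c' in C :\ c0 | lt c c') h c')%N * g (h c))).
  by rewrite IH /g exprD mulrBr mulr1 [_ ^+ h c0 * _]mulrC addrA addrNK.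
move=> c; rewrite in_setD1 => /andP[cc0 cC]; congr (_ ^+ _ * _).
by apply: eq_bigl => c'; rewrite eqC (c0min c cC cc0).2 andbF orbF.
Qed.

Variables (T : rtree) (e : embedding T).
Implicit Types (A : {set T}) (p u v w : T).

(* The factor that the hook of an ancestor [u] of a leaf loses when this leaf is
   plucked; when [u] is the leaf itself, its factor [g 1] disappears altogether,
   rather than becoming [g 0 = 0]. *)
Definition hook_ratio A u : F :=
  if hook A u == 1%N then g 1 else g (hook A u) / g (hook A u).-1.

(* The q-analogue of the hook walk: by induction on the tree, the walk towards
   the leaves enters the child [c] of [p] with total weight
   [q ^+ s * g (hook A c)], where [s] is the size of the branches to the right of
   [c], and these weights telescope by [sum_staircase]. *)
Lemma hook_walk A p : ancestor_closed A ->
  \sum_(v | ((v \in A) && (hook A v == 1%N)) && above p v)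
     q ^+ right_edges_below e A p v *
     \prod_(u | above u v && above p u) hook_ratio A u = g (hook A p).
Proof.
move=> Acl; elim/tree_ind: p => p IHp; rewrite sum_below /=.
pose R c := (\sum_(c' in children p | left_of e c c') hook A c')%N.
have -> : \sum_(c in children p) \sum_(v | ((v \in A) && (hook A v == 1%N)) && above c v)
     q ^+ right_edges_below e A p v *
     \prod_(u | above u v && above p u) hook_ratio A u =
  hook_ratio A p * g (\sum_(c in children p) hook A c)%N.
  rewrite -(sum_staircase _ (@left_of_irr _ e p) (@left_of_trans _ e p) (@left_of_total _ e p)).
  rewrite mulr_sumr; apply: eq_bigr => c cp.
  rewrite -IHp // !mulr_sumr; apply: eq_bigr => v /andP[_ cv].
  rewrite (right_edges_below_child _ _ cp cv) exprD.
  rewrite sum_below /= (above_trans (above_child cp) cv).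
  rewrite [X in _ * X](_ : _ = hook_ratio A p *
      \prod_(u | above u v && above c u) hook_ratio A u); first by rewrite mulrCA -!mulrA.
  congr (_ * _); rewrite (bigD1 c) //= [X in _ * X]big1 ?mulr1 // => c' /andP[c'p c'c].
  rewrite big_pred0 // => u; apply: contra_neqF c'c => /andP[uv c'u].
  exact: child_above_inj c'p cp (above_trans c'u uv) cv.
have := hook_rec A p; case: (boolP (p \in A)) => [pA|pA] /=; last first.
  rewrite (ancestor_closed_hook0 Acl pA) add0n => <-.
  by rewrite /g subrr mulr0 addr0.
(* With hook 1, [p] is itself the leaf where the walk ends. Otherwise the denominator of
   [hook_ratio A p] cancels the telescoped sum over the children. *)
move=> hp; case: eqP => [h1|h1].
  have s0 : (\sum_(c in children p) hook A c = 0)%N by apply/eqP; rewrite -(eqn_add2l 1) -hp h1.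
  rewrite s0 {1}/g subrr mulr0 addr0 right_edges_below_self mul1r.
  rewrite (big_pred1 p) => [|u]; first by rewrite /hook_ratio h1.
  by apply/andP/eqP=> [[up pu]|->]; [apply: above_antisym|split; apply: above_refl].
rewrite add0r /hook_ratio; case: eqP => // _; rewrite hp divfK //.
by apply: q_order; case: (\sum_(c in _) _)%N hp h1 => // ->.
Qed.

(** Plucking [v] lowers by one the hooks of its ancestors and changes no other hook. *)
Lemma hook_productD1 A v : ancestor_closed A -> (1 < #|A|)%N -> v \in leaves A ->
  \prod_(u in A) g (hook A u) =
  \prod_(u in A :\ v) g (hook (A :\ v) u) *
  \prod_(u | above u v && above (troot T) u) hook_ratio A u.
Proof.
move=> Acl A1; rewrite in_leaves // => /andP[vA /eqP hv].
have -> : \prod_(u | above u v && above (troot T) u) hook_ratio A u =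
          \prod_(u in A | above u v) hook_ratio A u.
  apply: eq_bigl => u; rewrite above_troot andbT andbC.
  by case: (boolP (above u v)) => //= uv; rewrite (ancestor_closed_above Acl uv vA).
have rv : hook_ratio A v = g 1 by rewrite /hook_ratio hv eqxx.
rewrite [X in _ = _ * X]big_mkcondr (big_setD1 v) //= [X in _ = _ * X](big_setD1 v) //=.
rewrite above_refl rv hv mulrCA; congr (_ * _).
rewrite -big_split /=; apply: eq_bigr => u uAv.
have uA := uAv; rewrite (hookD1 u vA) /hook_ratio (hookD1 u vA).
case: (above u v); last by rewrite addn0 mulr1.
(* A remaining ancestor keeps a positive hook, so its former hook was not 1 and its ratio is the
   genuine quotient. *)
have h0 := hook_gt0 uAv; rewrite addn1 /=; case: eqP => [|_]; first by case=> h; rewrite h in h0.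
by rewrite mulrC divfK //; apply: q_order.
Qed.

(** By induction, the summand of each leaf is the product for [k] vertices fewer by one times the
    weight of the walk to that leaf; by [hook_walk] at the root these weights add up to [g #|A|]. *)
Lemma plucking_rec_hooks (phi : {rmorphism {poly int} -> F}) k A :
    phi 'X = q -> ancestor_closed A -> troot T \in A -> #|A| = k.+1 ->
  phi (plucking_rec e k A) * \prod_(v in A) g (hook A v) =
  \prod_(i < k.+1) g i.+1.
Proof.
move=> phiX; elim: k A => [|k IHk] A Acl A0 Ak.
  have [a eA] : exists a, A = [set a] by apply/cards1P; rewrite Ak.
  have Ea : a = troot T by move: A0; rewrite eA inE => /eqP.
  by rewrite rmorph1 mul1r eA big_set1 big_ord1 -eA Ea hook_troot Ak.
have A1 : (1 < #|A|)%N by rewrite Ak.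
rewrite /= rmorph_sum mulr_suml /= big_ord_recr /=.
rewrite -Ak -hook_troot -hook_walk // mulr_sumr; apply: eq_big => v.
  by rewrite above_troot andbT in_leaves.
move=> vA; have /andP[vA' /eqP hv] : (v \in A) && (hook A v == 1%N) by rewrite -in_leaves.
rewrite -(IHk (A :\ v)).
- rewrite rmorphM rmorphXn /= phiX right_edges_troot (hook_productD1 Acl A1 vA).
  by rewrite [_ * phi _]mulrC mulrACA.
- exact: ancestor_closedD1.
- rewrite !inE A0 andbT; apply: contra_eq_neq hv => <-.
  by rewrite hook_troot Ak.
- by move: Ak; rewrite (cardsD1 v) vA' => -[].
Qed.

End HookWalk.

(** * The q-hook formula *)

Section HookFormula.
Local Open Scope ring_scope.

Lemma Xn_sub1_neq0 (R : nzRingType) n : (0 < n)%N -> ('X^n - 1 : {poly R}) != 0.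
Proof. by move=> n0; rewrite -size_poly_eq0 size_XnsubC. Qed.

Definition hook_poly (T : rtree) : {poly int} :=
  \prod_(v : T) ('X^(hook setT v) - 1).

Lemma hook_poly_neq0 T : hook_poly T != 0.
Proof. by apply/prodf_neq0 => v _; apply/Xn_sub1_neq0/hookT_gt0. Qed.

(** This is [('X - 1) ^+ n] times the q-factorial of [n]. *)
Definition Xfact n : {poly int} := \prod_(i < n) ('X^(i.+1) - 1).

Lemma Xfact_neq0 n : Xfact n != 0.
Proof. by apply/prodf_neq0 => i _; apply: Xn_sub1_neq0. Qed.

(** The hook walk divides by hook factors, so it is run in the field of fractions, where ['X] is not
    a root of unity. *)
Lemma plucking_hook_poly (T : rtree) (e : embedding T) :
  plucking e * hook_poly T = Xfact #|T|.
Proof.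
apply/eqP; rewrite -tofrac_eq; apply/eqP.
have qn n : (0 < n)%N -> (tofrac ('X : {poly int})) ^+ n - 1 != 0.
  by move=> n0; rewrite -tofracXn -tofrac1 -tofracB tofrac_eq0 Xn_sub1_neq0.
have cT : #|[set: T]| = #|T|.-1.+1.
  by rewrite cardsT prednK //; apply/card_gt0P; exists (troot T).
have Tcl : ancestor_closed [set: T] by move=> w _; rewrite inE.
have := @plucking_rec_hooks _ _ qn T e (@tofrac {poly int}) _ setT erefl Tcl (in_setT _) cT.
rewrite tofracM /hook_poly /Xfact !rmorph_prod -cT cardsT => H.
under eq_bigr do rewrite rmorphB rmorphXn rmorph1.
under [RHS]eq_bigr do rewrite rmorphB rmorphXn rmorph1.
by rewrite -H; congr (_ * _); apply: eq_bigl => v; rewrite inE.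
Qed.

End HookFormula.

(** * Recovering exponents from a product of ['X^k - 1] *)

Section ProdXnSub1.
Local Open Scope ring_scope.

(** A primitive [h]-th root of unity is a zero of the left product, hence of some factor on the
    right. *)
Lemma prod_Xn_sub1_dvd (s t : seq nat) (h : nat) :
    \prod_(k <- s) ('X^k - 1) = \prod_(k <- t) ('X^k - 1) :> {poly int} ->
  (0 < h)%N -> h \in s -> exists2 k, k \in t & (h %| k)%N.
Proof.
move=> st h0 hs; have [z zh] := C_prim_root_exists h0.
have evalE (r : seq nat) :
    (map_poly intr (\prod_(k <- r) ('X^k - 1) : {poly int})).[z] =
    \prod_(k <- r) (z ^+ k - 1).
  rewrite rmorph_prod horner_prod; apply: eq_bigr => k _.
  by rewrite rmorphB rmorphXn rmorph1 /= map_polyX !hornerE.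
have : \prod_(k <- t) (z ^+ k - 1) = 0.
  by rewrite -evalE -st evalE (big_rem h) //= prim_expr_order // subrr mul0r.
move/eqP; rewrite prodf_seq_eq0 => /hasP[k kt /=].
by rewrite subr_eq0 => zk; exists k => //; rewrite (prim_order_dvd zh).
Qed.

(** The largest [m] in [s] divides some [m'] in [t], which divides some [m2] in [s]; as [m2 <= m],
    all three agree. The common factor is cancelled and the argument repeated. *)
Lemma prod_Xn_sub1_inj (s t : seq nat) :
    all (leq 1) s -> all (leq 1) t ->
    \prod_(k <- s) ('X^k - 1) = \prod_(k <- t) ('X^k - 1) :> {poly int} ->
  perm_eq s t.
Proof.
have [n] := ubnP (size s); elim: n s t => // n IHn s t sn /allP s0 /allP t0 st.
have [s_nil|[m ms mmax]] : s = [::] \/ exists2 m, m \in s & {in s, forall k, k <= m}%N.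
  elim: (s) => [|a r [->|[m mr mmax]]]; [by left|right|right].
    by exists a => [|k]; rewrite ?inE // => /eqP ->.
  exists (maxn a m).
    by rewrite /maxn; case: ifP; rewrite !inE ?mr ?eqxx ?orbT.
  by move=> k; rewrite inE leq_max => /predU1P[->|/mmax ->]; rewrite ?leqnn ?orbT.
  case: t t0 st => [|b t] t0 st; first by rewrite s_nil.
  have [|//|k] := prod_Xn_sub1_dvd (esym st) (t0 b _) _; rewrite ?inE ?eqxx //.
  by rewrite s_nil.
have [m' m't mm'] := prod_Xn_sub1_dvd st (s0 m ms) ms.
have [m2 m2s m'm2] := prod_Xn_sub1_dvd (esym st) (t0 m' m't) m't.
have Em : m' = m.
  apply/eqP; rewrite eqn_leq (dvdn_leq (t0 _ m't) mm') andbT.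
  exact: leq_trans (dvdn_leq (s0 _ m2s) m'm2) (mmax _ m2s).
rewrite Em in m't.
rewrite (permPl (perm_to_rem ms)) (permPr (perm_to_rem m't)) perm_cons.
apply: IHn.
- by rewrite size_rem //; case: (s) ms sn.
- by apply/allP=> k /mem_rem/s0.
- by apply/allP=> k /mem_rem/t0.
apply: (mulfI (@Xn_sub1_neq0 int m (s0 m ms))).
by move: st; rewrite (big_rem m ms) [RHS](big_rem m m't).
Qed.

Lemma perm_map_bij (I J : finType) (X : eqType) (h : I -> X) (k : J -> X) :
  perm_eq (map h (enum I)) (map k (enum J)) ->
  exists2 f : I -> J, bijective f & forall i, k (f i) = h i.
Proof.
move=> hk; have E : #|I| = #|J| by have := perm_size hk; rewrite (size_map h) (size_map k) -!cardT.
have sI : size (map h (enum I)) == #|I| by rewrite size_map -cardT.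
have sJ : size (map k (enum J)) == #|I| by rewrite size_map -cardT E.
have /tuple_permP[p Ep] : perm_eq (Tuple sI) (Tuple sJ) by [].
exists (fun i => enum_val (cast_ord E (p (enum_rank i)))).
  exists (fun j => enum_val (p^-1%g (cast_ord (esym E) (enum_rank j)))) => x.
    by rewrite enum_valK cast_ordK permK enum_rankK.
  by rewrite enum_valK permKV cast_ordKV enum_rankK.
move=> i; have := congr1 (fun s => nth (h i) s (enum_rank i)) Ep.
rewrite (nth_map i) -?cardE // nth_enum_rank => ->.
rewrite -tnth_nth tnth_mktuple (tnth_nth (h i)) /=.
(* A default value for [nth]: [J] is inhabited because [I] is. *)
have j0 : J by exact: enum_val (cast_ord E (enum_rank i)).
by rewrite (nth_map j0) -?cardE -?E // (enum_val_nth j0).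
Qed.

End ProdXnSub1.

(** * Hook polynomials under isomorphism and destabilization *)

Section Invariance.
Local Open Scope ring_scope.

(** Cross-multiplying the two hook formulas eliminates the embeddings. *)
Lemma plucking_eqP (T T' : rtree) (e : embedding T) (e' : embedding T') :
  plucking e = plucking e' <->
  hook_poly T * Xfact #|T'| = hook_poly T' * Xfact #|T|.
Proof.
have HT := hook_poly_neq0 T; have HT' := hook_poly_neq0 T'.
rewrite -(plucking_hook_poly e) -(plucking_hook_poly e').
split=> [->|]; first by rewrite mulrCA [RHS]mulrCA [hook_poly T * _]mulrC.
rewrite mulrCA [RHS]mulrCA [hook_poly T' * _]mulrC => /mulIf -> //.
by rewrite mulf_neq0.
Qed.

Lemma hook_poly_perm (T T' : rtree) :
  hook_poly T = hook_poly T' ->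
  exists2 f : T -> T', bijective f & forall v, hook setT (f v) = hook setT v.
Proof.
move=> HT; apply: perm_map_bij; apply: prod_Xn_sub1_inj.
- by apply/allP=> _ /mapP[v _ ->]; apply: hookT_gt0.
- by apply/allP=> _ /mapP[v _ ->]; apply: hookT_gt0.
by rewrite !(big_map (hook setT)) !big_enum.
Qed.

Lemma hook_poly_bij (T T' : rtree) (f : T -> T') :
  bijective f -> (forall v, hook setT (f v) = hook setT v) ->
  hook_poly T = hook_poly T' /\ #|T| = #|T'|.
Proof.
move=> fbij fh; split; last exact: bij_eq_card fbij.
rewrite /hook_poly [RHS](reindex f); last exact: onW_bij.
by apply: eq_bigr => v _; rewrite fh.
Qed.

Lemma iter_parent_morph (T T' : rtree) (f : T -> T') :
  (forall v, f (parent v) = parent (f v)) ->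
  forall k v, f (iter k (@parent T) v) = iter k (@parent T') (f v).
Proof. by move=> fp; elim=> //= k IHk v; rewrite fp IHk. Qed.

Lemma above_morph (T T' : rtree) (f : T -> T') :
  (forall v, f (parent v) = parent (f v)) ->
  forall v w, above v w -> above (f v) (f w).
Proof.
move=> fp v w /iter_findex <-; rewrite iter_parent_morph //.
exact: fconnect_iter.
Qed.

Lemma tree_iso_hook_poly (T T' : rtree) : tree_iso T T' ->
  hook_poly T = hook_poly T' /\ #|T| = #|T'|.
Proof.
case=> f [fbij f0 fp]; apply: (hook_poly_bij fbij) => v.
have finj := bij_inj fbij.
rewrite /hook -(card_imset _ finj); apply: eq_card => w'; rewrite !inE.
have [g fK gK] := fbij.
apply/idP/imsetP=> [vw|[w]]; last by rewrite !inE => vw ->; apply: above_morph.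
exists (g w') => //; rewrite !inE; rewrite -[w']gK in vw.
rewrite gK in vw; rewrite -[v]fK; apply: (above_morph (f := g) _ vw) => u'.
by apply: finj; rewrite fp !gK.
Qed.

(** The contraction maps the non-root vertices bijectively onto [T'] and keeps their hooks; the
    extra factor comes from the old root. *)
Lemma destabilization_hook_poly (T T' : rtree) : destabilization T T' ->
  hook_poly T = hook_poly T' * ('X^(#|T'|.+1) - 1) /\ #|T| = #|T'|.+1.
Proof.
case=> c [f [root_c fsurj feq f0 fp]].
have /childP[c0 pc] : c \in children (troot T) by rewrite root_c set11.
have fc0 : f c = f (troot T).
  by apply/feq; right; rewrite !inE !eqxx orbT.
have above_c w : w != troot T -> above c w.
  move=> w0; have [d] := above_via_child (above_troot w) w0.
  by rewrite root_c inE => /eqP ->.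
have finj : {in [set~ troot T] &, injective f}.
  move=> u v; rewrite !inE => u0 v0 /feq[//|[]].
  by rewrite !inE (negPf u0) (negPf v0) => /eqP -> /eqP.
have fim : f @: [set~ troot T] = [set: T'].
  apply/setP=> v'; rewrite inE; have [v <-] := fsurj v'.
  have [->|v0] := eqVneq v (troot T); apply/imsetP; last by exists v; rewrite ?inE.
  by exists c; rewrite ?inE.
have cT : #|T| = #|T'|.+1.
  by rewrite -[#|T'|]cardsT -fim card_in_imset // cardsC1 prednK //; apply/card_gt0P; exists c.
have hf v : v != troot T -> hook setT (f v) = hook setT v.
  move=> v0; rewrite /hook -[RHS](card_in_imset (f := f)); last first.
    have sub w : w \in [set w in setT | above v w] -> w \in [set~ troot T].
      rewrite !inE; apply: contraTneq => ->; by rewrite above_rootE.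
    by move=> w1 w2 /sub ? /sub ?; apply: finj.
  apply: eq_card => w'; rewrite !inE.
  apply/idP/imsetP=> [vw|[w]]; last by rewrite !inE => vw ->; apply: above_morph.
  have : w' \in f @: [set~ troot T] by rewrite fim inE.
  case/imsetP=> w; rewrite !inE => w0 Ew; exists w => //; rewrite !inE.
  (* An ancestor of [w] with the same image as [v] is either [v] itself or identified with it; in
     the second case [v] is [c], which is above every non-root vertex. *)
  move: vw; rewrite Ew => /iter_findex; rewrite -iter_parent_morph // => /feq[<-|[]].
    exact: fconnect_iter.
  by rewrite !inE (negPf v0) => _ /eqP ->; apply: above_c.
split=> //; rewrite /hook_poly (bigD1 (troot T)) //= hook_troot cardsT cT mulrC.
congr (_ * _).
transitivity (\prod_(v in f @: [set~ troot T]) ('X^(hook setT v) - 1) : {poly int}).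
  rewrite big_imset //=; apply: eq_big => v; first by rewrite !inE.
  by move=> v0; rewrite hf.
by apply: eq_bigl => v; rewrite fim inE.
Qed.

End Invariance.

(** * Partitions into consecutive blocks *)

Section Blocks.

Lemma block_exists n m (a : nat -> nat) (j : 'I_m) :
  a 0 = 0 -> a n = m -> exists i : 'I_n, block a i j.
Proof.
move=> a0 an; suff /(_ n)[|i ni ij] : forall k, j < a k -> exists2 i, i < k & block a i j.
- by rewrite an.
- by exists (Ordinal ni).
elim=> [|k IHk]; first by rewrite a0.
case: (ltnP j (a k)) => [/IHk[i ik ij] _|kj jk]; first by exists i => //; apply: leqW.
by exists k => //; rewrite /block kj.
Qed.

Lemma block_eq n m (a : nat -> nat) (i i' : 'I_n) (j : 'I_m) :
  (forall i : 'I_n, a i < a i.+1) -> block a i j -> block a i' j = (i == i').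
Proof.
move=> a_lt ij; apply/idP/eqP=> [i'j|<- //]; apply: val_inj => /=.
have a_le k l : k <= l -> l <= n -> a k <= a l.
  elim: l => [|l IHl]; first by rewrite leqn0 => /eqP ->.
  rewrite leq_eqVlt => /predU1P[-> //|kl ln].
  by apply: leq_trans (IHl kl (ltnW ln)) _; apply: ltnW (a_lt (Ordinal ln)).
have disj (k l : 'I_n) : block a k j -> block a l j -> ~~ (k < l).
  move=> /andP[_ jk] /andP[lj _]; apply/negP=> /a_le /(_ (ltnW (ltn_ord l))) kl.
  by have := leq_trans jk (leq_trans kl lj); rewrite ltnn.
by apply/eqP; rewrite eqn_leq leqNgt (disj i' i) // leqNgt (disj i i').
Qed.

(* Listing [A] by increasing [g] makes the fibres of [g] consecutive blocks. *)
Lemma block_enumeration (I : finType) (A : {set I}) (n : nat) (g : I -> nat) :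
    {in A, forall w, g w < n} ->
  exists (x : 'I_#|A| -> I) (a : nat -> nat),
    [/\ injective x, x @: setT = A, a 0 = 0, a n = #|A|
      & forall i j, block a i j = (g (x j) == i)].
Proof.
move=> gn; pose s := sort (relpre g leq) (enum A).
have ss : size s = #|A| by rewrite size_sort -cardE.
have sE : s =i A by move=> w; rewrite mem_sort mem_enum.
have us : uniq s by rewrite sort_uniq enum_uniq.
have srt : sorted leq (map g s).
  by rewrite sorted_map; apply: sort_sorted => u v; apply: leq_total.
(* The number of keys below [i] is the position where block [i] starts. *)
pose a i := count (fun k => k < i) (map g s).
exists (fun j => nth (enum_val j) s j), a.
have inj : injective (fun j : 'I_#|A| => nth (enum_val j) s j).
  move=> j k; rewrite (set_nth_default (enum_val k)) ?ss // => /eqP.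
  by rewrite nth_uniq ?ss // => /eqP/val_inj.
split=> //.
- apply/eqP; rewrite eqEcard card_imset // cardsT card_ord leqnn andbT.
  by apply/subsetP=> _ /imsetP[j _ ->]; rewrite -sE mem_nth ?ss.
- by apply/eqP; rewrite /a -leqn0 leqNgt -has_count; apply/hasP=> -[].
- rewrite /a (@eq_in_count _ _ predT) ?count_predT ?size_map //.
  by move=> _ /mapP[w ws ->]; rewrite /= gn // -sE.
move=> i j.
have lt_a k : (j < a k) = (g (nth (enum_val j) s j) < k).
  have js : j < size (map g s) by rewrite size_map ss.
  rewrite -(nth_map _ 0) ?ss //.
  apply/idP/idP=> [|gk]; first exact: (Order.POrderTheory.nth_count_lt 0 srt).
  rewrite ltnNge; apply/negP=> kj; move: gk; rewrite ltnNge; case/negP.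
  by apply: (Order.TotalTheory.DualTotalTheory.nth_count_ge 0 srt); apply/andP.
by rewrite /block leqNgt !lt_a ltnS -leqNgt eqn_leq andbC.
Qed.

End Blocks.

(** * Permutation moves preserve hooks *)

Lemma card_branch_edges_hook (T : rtree) (v : T) (B : {set T}) :
  B \subset children v -> #|branch_edges B| = \sum_(w in B) hook setT w.
Proof.
by move=> Bv; rewrite (card_branch_edges Bv); apply: eq_bigr => w _; rewrite descendants_hook.
Qed.

(** At every vertex, the old and the new children have the same total of old hooks: by the size
    condition at the [v i], and because the children stay the same elsewhere. So the old hooks
    satisfy the recursion of the new tree, which determines its hooks. *)
Lemma permutation_move_hook_poly (T T' : rtree) : permutation_move T T' ->
  hook_poly T = hook_poly T' /\ #|T| = #|T'|.
Proof.
case=> n m v alpha beta B P f n_gt0 v_inj alpha0 alpha_lt alphan beta0 beta_lt betan.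
move=> B_children B_disj P_size fbij froot f_moved f_kept.
apply: (hook_poly_bij fbij) => u0; have finj := bij_inj fbij.
have Bch (i : 'I_n) (j : 'I_m) : block alpha i j -> B j \subset children (v i).
  by case/B_children.
have block_a (j : 'I_m) : exists i : 'I_n, block alpha i j by apply: block_exists.
have block_b (j : 'I_m) : exists i : 'I_n, block beta i j by apply: block_exists.
have Btriv (j k : 'I_m) : j != k -> [disjoint B j & B k].
  move=> jk; have [i ij] := block_a j; have [i' i'k] := block_a k.
  have [Ei|ii'] := eqVneq i i'; first by rewrite -Ei in i'k; apply: (B_disj i).
  rewrite disjoint_subset; apply/subsetP=> w wj; rewrite inE; apply: contra ii' => wk.
  have /childP[_ wi] := subsetP (Bch _ _ ij) _ wj.
  have /childP[_ wi'] := subsetP (Bch _ _ i'k) _ wk.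
  by apply/eqP/v_inj; rewrite -wi -wi'.
pose M := \bigcup_j B j.
have M0 w : w \in M -> w != troot T.
  case/bigcupP=> j _ wj; have [i ij] := block_a j.
  by have /childP[] := subsetP (Bch _ _ ij) _ wj.
(* Taking [s = P] groups the moved vertices by their new parent, and [s = 1] by their old one. *)
have sumM (s : {perm 'I_m}) (key : pred T) (bkey : pred 'I_m) :
    (forall j w, w \in B (s j) -> key w = bkey j) ->
    \sum_(w in M | key w) hook setT w =
    \sum_(j < m | bkey j) \sum_(w in B (s j)) hook setT w.
  move=> keyE; rewrite big_mkcondr partition_disjoint_bigcup //.
  rewrite (reindex_inj (@perm_inj _ s)) [RHS]big_mkcond /=; apply: eq_bigr => j _.
  case bj: (bkey j).
    by apply: eq_bigr => w wj; rewrite (keyE j) ?bj.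
  by apply: big1 => w wj; rewrite (keyE j) ?bj.
have sumE u : \sum_(w in T | (w != troot T) && (parent (f w) == f u)) hook setT w =
              \sum_(w in children u) hook setT w.
  rewrite (bigID (mem M)) [RHS](bigID (mem M)) /=; congr (_ + _); last first.
    apply: eq_bigl => w; rewrite inE -!andbA; case: eqVneq => //= w0.
    case: (boolP (w \in M)) => wM; rewrite ?andbF // f_kept ?(inj_eq finj) // => j.
    by apply: contra wM => wj; apply/bigcupP; exists j.
  transitivity (\sum_(w in M | parent (f w) == f u) hook setT w).
    apply: eq_bigl => w; case: (boolP (w \in M)) => [/M0 ->|]; rewrite ?andbF ?andbT //.
  transitivity (\sum_(w in M | parent w == u) hook setT w); last first.
    apply: eq_bigl => w; rewrite inE.
    by case: (boolP (w \in M)) => [/M0 ->|]; rewrite ?andbF ?andbT.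
  have keyb (j : 'I_m) (i : 'I_n) w : block beta i j -> w \in B (P j) ->
      (parent (f w) == f u) = (v i == u).
    by move=> ij wj; rewrite (f_moved _ _ _ ij wj) (inj_eq finj).
  have keya (j : 'I_m) (i : 'I_n) w : block alpha i j -> w \in B j ->
      (parent w == u) = (v i == u).
    by move=> ij wj; have /childP[_ ->] := subsetP (Bch _ _ ij) _ wj.
  case: (boolP [exists i, v i == u]) => [/existsP[i /eqP vi]|nu].
    rewrite (sumM P _ (fun j => block beta i j)); last first.
      move=> j w wj; have [i' i'j] := block_b j.
      by rewrite (keyb _ _ _ i'j wj) -vi (inj_eq v_inj) (block_eq _ beta_lt i'j).
    rewrite (sumM 1%g _ (fun j => block alpha i j)); last first.
      move=> j w; rewrite perm1 => wj; have [i' i'j] := block_a j.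
      by rewrite (keya _ _ _ i'j wj) -vi (inj_eq v_inj) (block_eq _ alpha_lt i'j).
    under [RHS]eq_bigr => j ij do rewrite perm1 -(card_branch_edges_hook (Bch _ _ ij)).
    rewrite P_size; apply: eq_bigr => j _; have [i' i'j] := block_a (P j).
    by rewrite -(card_branch_edges_hook (Bch _ _ i'j)).
  have nvu i : (v i == u) = false by apply: contraNF nu => vi; apply/existsP; exists i.
  rewrite (sumM P _ pred0) => [|j w wj]; last first.
    by have [i ij] := block_b j; rewrite (keyb _ _ _ ij wj) nvu.
  rewrite (sumM 1%g _ pred0) ?big_pred0_eq // => j w; rewrite perm1 => wj.
  by have [i ij] := block_a j; rewrite (keya _ _ _ ij wj) nvu.
have [g fK gK] := fbij.
rewrite -(@hook_unique _ (fun u' => hook setT (g u'))) ?fK // => p.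
rewrite -[p]gK fK hook_rec inE; congr (_ + _); rewrite -sumE.
rewrite [RHS](reindex f) /=; last exact: onW_bij.
apply: eq_big => [w|w _]; last by rewrite fK.
by rewrite !inE -froot (inj_eq finj).
Qed.

(** * From a hook-preserving bijection to a permutation move *)

Lemma sum_hook_children (T : rtree) (p : T) :
  \sum_(c in children p) hook setT c = (hook setT p).-1.
Proof. by rewrite [in RHS]hook_rec inE. Qed.

Lemma hook_gt1_child (T : rtree) (p : T) :
  1 < hook setT p -> exists c, c \in children p.
Proof.
rewrite hook_rec inE => hp; have [c0|[c cp]] := set_0Vmem (children p); last by exists c.
by rewrite c0 big_set0 in hp.
Qed.

Lemma permutation_move_of_hooks (T T' : rtree) (f : T -> T') :
  bijective f -> (forall v, hook setT (f v) = hook setT v) -> 1 < #|T| ->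
  permutation_move T T'.
Proof.
move=> fbij fh T1; have finj := bij_inj fbij; have [fi fK fiK] := fbij.
(* Only the root has a hook equal to the number of vertices. *)
have froot : f (troot T) = troot T'.
  apply/eqP/contraT => /hookT_max.
  by rewrite fh hook_troot cardsT (bij_eq_card fbij) ltnn.
(* [D] consists of the vertices with children. As [f] preserves hooks, these have children after the
   move too, so that no block of [alpha] or [beta] is empty. *)
pose D := [set v : T | 1 < hook setT v]; pose A := [set~ troot T].
have D0 : troot T \in D by rewrite inE hook_troot cardsT.
have hook_parent S (w : vertex S) : w != troot S -> 1 < hook setT (parent w).
  move=> w0; apply: leq_ltn_trans (hookT_gt0 w) (hook_child _).
  by apply/childP.
have Dp w : w \in A -> parent w \in D by rewrite !inE => /hook_parent.
have Dp' w : w \in A -> fi (parent (f w)) \in D.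
  by rewrite !inE -fh fiK => w0; apply: hook_parent; rewrite -froot (inj_eq finj).
pose v (i : 'I_#|D|) : T := enum_val i.
pose rk := enum_rank_in D0.
have rkE u (i : 'I_#|D|) : u \in D -> (rk u == i :> nat) = (u == v i).
  move=> uD; apply/eqP/eqP=> [/val_inj <-|->].
    by rewrite /v enum_rankK_in.
  by rewrite /rk /v enum_valK_in.
(* The non-root vertices are listed twice: [x] groups them by old parent, [y] by new parent. *)
have [x [alpha [x_inj xA alpha0 alphan alphaE]]] :=
  @block_enumeration _ A #|D| (fun w => rk (parent w)) (fun w _ => ltn_ord _).
have [y [beta [y_inj yA beta0 betan betaE]]] :=
  @block_enumeration _ A #|D| (fun w => rk (fi (parent (f w)))) (fun w _ => ltn_ord _).
have xinA (j : 'I_#|A|) : x j \in A by have := imset_f x (in_setT j); rewrite xA.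
have yinA (j : 'I_#|A|) : y j \in A by have := imset_f y (in_setT j); rewrite yA.
have alpha_block (i : 'I_#|D|) (j : 'I_#|A|) : block alpha i j = (parent (x j) == v i).
  by rewrite alphaE rkE ?Dp.
have beta_block (i : 'I_#|D|) (j : 'I_#|A|) : block beta i j = (parent (f (y j)) == f (v i)).
  by rewrite betaE rkE ?Dp' // -(inj_eq finj) fiK.
have xsurj w : w \in A -> exists j, x j == w.
  move=> wA; have : w \in x @: setT by rewrite xA.
  by case/imsetP=> j _ ->; exists j.
have ysurj w : w \in A -> exists j, y j == w.
  move=> wA; have : w \in y @: setT by rewrite yA.
  by case/imsetP=> j _ ->; exists j.
(* The permutation translates one listing into the other, so that the singleton at place [p j] is
   [y j]. *)
pose p j := xchoose (xsurj _ (yinA j)).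
have pE j : x (p j) = y j by apply/eqP/(xchooseP (xsurj _ (yinA j))).
have p_inj : injective p by move=> j k jk; apply: y_inj; rewrite -!pE jk.
have sum_block (z : 'I_#|A| -> T) (c : pred T) : injective z -> z @: setT = A ->
    \sum_(j | c (z j)) hook setT (z j) = \sum_(w in A | c w) hook setT w.
  move=> z_inj zA; transitivity (\sum_(w in z @: setT | c w) hook setT w); last by rewrite zA.
  rewrite big_mkcond [RHS]big_mkcondr /= big_imset /=; last by move=> ? ? _ _; apply: z_inj.
  by apply: eq_bigl => j; rewrite inE.
have branch1 w : w \in A -> #|branch_edges [set w]| = hook setT w.
  move=> wA; rewrite (@card_branch_edges_hook _ (parent w)) ?big_set1 //.
  by rewrite sub1set; apply/childP; split=> //; rewrite !inE in wA.
apply: (@PermutationMove T T' #|D| #|A| v alpha beta (fun j => [set x j]) (perm p_inj) f) => //.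
- by apply/card_gt0P; exists (troot T).
- by move=> i j /enum_val_inj.
- move=> i; have [|c /childP[c0 ci]] := @hook_gt1_child _ (v i).
    by have := enum_valP i; rewrite inE.
  have [|j /eqP xj] := xsurj c; first by rewrite !inE.
  have : block alpha i j by rewrite alpha_block xj ci.
  by case/andP; apply: leq_ltn_trans.
- move=> i; have [|c /childP[c0 ci]] := @hook_gt1_child _ (f (v i)).
    by rewrite fh; have := enum_valP i; rewrite inE.
  have [|j /eqP yj] := ysurj (fi c).
    by rewrite !inE -(inj_eq finj) fiK froot.
  have : block beta i j by rewrite beta_block yj fiK ci.
  by case/andP; apply: leq_ltn_trans.
- move=> i j; rewrite alpha_block => xj; split; first by apply/set0Pn; exists (x j); rewrite inE.
  by rewrite sub1set inE xj andbT; have := xinA j; rewrite !inE.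
- by move=> _ j k _ _ jk; rewrite disjoints1 inE (inj_eq x_inj).
- move=> i; under eq_bigr => j _ do rewrite branch1 //.
  under [RHS]eq_bigr => j _ do rewrite permE pE branch1 //.
  under eq_bigl => j do rewrite alpha_block.
  under [RHS]eq_bigl => j do rewrite beta_block.
  rewrite (sum_block x (fun w => parent w == v i)) //.
  rewrite (sum_block y (fun w => parent (f w) == f (v i))) //.
  transitivity (hook setT (v i)).-1.
    by rewrite -sum_hook_children; apply: eq_bigl => w; rewrite !inE.
  rewrite -fh -sum_hook_children (reindex f) /=; last exact: onW_bij.
  by apply: eq_big => [w|w _]; rewrite ?fh // !inE -froot (inj_eq finj).
- by move=> i j w; rewrite beta_block permE inE pE => /eqP yj /eqP ->.
move=> w w0 wB; have [|j /eqP xj] := xsurj w; first by rewrite !inE.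
by have := wB j; rewrite inE xj eqxx.
Qed.

(** * Stabilized trees *)

Section Stabilization.
Variable T : rtree.

Definition stab_parent (o : option T) : option T :=
  if o is Some v then if v == troot T then None else Some (parent v) else None.

Lemma stab_parent_connect o : fconnect stab_parent o None.
Proof.
case: o => [v|]; last exact: connect0.
have /iter_findex := parent_connect v; move: (findex _ _ _) => k; elim: k v => [|k IHk] v.
  by move=> /= ->; apply: connect1; rewrite /= eqxx.
rewrite iterSr => /IHk; have [->|v0] := eqVneq v (troot T).
  by move=> _; apply: connect1; rewrite /= eqxx.
by apply: connect_trans; apply: connect1; rewrite /= (negPf v0).
Qed.

Definition stab_tree : rtree :=
  @RTree (option T) None stab_parent erefl stab_parent_connect.

Lemma stab_tree_destabilization : destabilization stab_tree T.
Proof.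
exists (Some (troot T) : stab_tree), (odflt (troot T)); split=> //.
- apply/setP=> -[v|]; rewrite !inE //=.
  by rewrite (inj_eq Some_inj); case: (v == troot T).
- by move=> v; exists (Some v).
- move=> [u|] [v|]; rewrite !inE /=; split=> //.
  + by move=> ->; left.
  + by case=> [[]//|[/eqP[->] /eqP[->]]].
  + by move=> ->; right; rewrite eqxx.
  + by case=> // -[/eqP[->]].
  + by move=> <-; right; rewrite eqxx.
  + by case=> // -[_ /eqP[->]].
  + by left.
by case=> [v|] /=; [case: eqP => [->|]|]; rewrite /= ?parent_troot.
Qed.

End Stabilization.

Lemma tree_iso_refl (T : rtree) : tree_iso T T.
Proof. by exists id; split=> //; exists id. Qed.

(** Pads a tree to any larger number of vertices. The last two clauses attach the padded tree to the
    end or to the beginning of a sequence without adding a permutation move. *)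
Lemma tree_moves_stab (T : rtree) (k : nat) :
  exists T1 : rtree, [/\ #|T1| = #|T| + k, tree_moves 0 T1 T
    & forall j (T' : rtree), tree_moves j T1 T' -> tree_moves j T T'].
Proof.
elim: k => [|k [T1 [cT1 T1T TT1]]].
  by exists T; split; rewrite ?addn0 //; apply/MovesIso/tree_iso_refl.
have ds := stab_tree_destabilization T1.
exists (stab_tree T1); split.
- by rewrite (destabilization_hook_poly ds).2 cT1 addnS.
- exact: MovesDestab ds T1T.
- by move=> j T' /(MovesStab ds) /TT1.
Qed.

(** * Invariance under all moves, and the equivalence *)

Definition same_plucking (T T' : rtree) : Prop :=
  forall (e : embedding T) (e' : embedding T'), plucking e = plucking e'.

Lemma same_plucking_trans T T1 T' :
  same_plucking T T1 -> same_plucking T1 T' -> same_plucking T T'.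
Proof.
by have [e1] := embedding_exists T1 => TT1 T1T' e e'; rewrite (TT1 e e1).
Qed.

Lemma same_plucking_of_hooks T T' :
  hook_poly T = hook_poly T' /\ #|T| = #|T'| -> same_plucking T T'.
Proof. by case=> hT cT e e'; apply/plucking_eqP; rewrite hT cT. Qed.

(** The hook of the old root contributes exactly the last factor of [Xfact #|T|]. *)
Lemma same_plucking_destab T T' : destabilization T T' -> same_plucking T T'.
Proof.
move=> /destabilization_hook_poly[hT cT] e e'; apply/plucking_eqP.
by rewrite hT cT /Xfact big_ord_recr /= -mulrA [(_ * \prod_(i < _) _)%R]mulrC.
Qed.

Lemma tree_moves_plucking k T T' : tree_moves k T T' -> same_plucking T T'.
Proof.
elim=> {k T T'} [T T' /tree_iso_hook_poly/same_plucking_of_hooks//|k T T1 T'|k T T1 T'|k T T1 T'].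
- by move=> /same_plucking_destab st _; apply: same_plucking_trans => e e'.
- by move=> /same_plucking_destab st _; apply: same_plucking_trans.
- by move=> /permutation_move_hook_poly/same_plucking_of_hooks st _; apply: same_plucking_trans.
Qed.

Theorem theorem1p2 (TI TII : rtree) (eI : embedding TI) (eII : embedding TII) :
  plucking eI = plucking eII <-> tree_moves 1 TI TII.
Proof.
split=> [eqQ|/tree_moves_plucking/(_ eI eII) //].
(* Each tree is padded by the size of the other, so both end up with [#|TI| + #|TII|] vertices. *)
have [T1 [c1 T1I IT1]] := tree_moves_stab TI #|TII|.
have [T2 [c2 T2II IIT2]] := tree_moves_stab TII #|TI|.
have c12 : #|T1| = #|T2| by rewrite c1 c2 addnC.
have [[e1] [e2]] := (embedding_exists T1, embedding_exists T2).
have : plucking e1 = plucking e2.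
  by rewrite (tree_moves_plucking T1I e1 eI) eqQ -(tree_moves_plucking T2II e2).
(* With equally many vertices the factors [Xfact] cancel and leave equal hook polynomials. *)
move/plucking_eqP; rewrite c12 => /(mulIf (Xfact_neq0 _)) /hook_poly_perm[f fbij fh].
apply: IT1; apply: MovesPerm T2II; apply: permutation_move_of_hooks fbij fh _.
by rewrite c1 -(addn1 1) leq_add //; apply/card_gt0P; [exists (troot TI)|exists (troot TII)].
Qed.
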